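(* Let $N\ge 2$ and let $H\in\mathbb{R}^{N(n+1)\times N(n+1)}$ be a block diagonal matrix with diagonal blocks $H_i\in\mathbb{R}^{(n+1)\times(n+1)}$, $1\le i\le N$, each of the form $$H_i=\begin{bmatrix}A_i & v_i \\ v_i^T & \alpha_i\end{bmatrix},\qquad A_i\in\mathbb{R}^{n\times n},\ v_i\in\mathbb{R}^n,\ \alpha_i\in\mathbb{R}.$$ Let each of $A_1$ and $A_N$ be either symmetric positive definite or symmetric negative definite, and let $A_i=0$ for $2\le i\le N-1$. Moreover, assume that for each $2\le i\le N-1$ at least one of $v_i$ and $\alpha_i$ is nonzero. Then the maximum dimension of the null-space of $H$ (over all matrices $H$ satisfying these assumptions, for given $n$ and $N$) is $(N-2)n+2$. *)

(* Defs.v *)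
From mathcomp Require Import all_boot all_order all_algebra.
From mathcomp Require Import reals.

Set Implicit Arguments.
Unset Strict Implicit.
Unset Printing Implicit Defensive.

Import Order.TTheory GRing.Theory Num.Theory.
Local Open Scope ring_scope.

Definition sym_posdef (R : realType) (n : nat) (A : 'M[R]_n) : Prop :=
  A^T = A /\ forall x : 'cV[R]_n, x != 0 -> 0 < (x^T *m A *m x) 0 0.

Definition sym_negdef (R : realType) (n : nat) (A : 'M[R]_n) : Prop :=
  A^T = A /\ forall x : 'cV[R]_n, x != 0 -> (x^T *m A *m x) 0 0 < 0.

(* [kermx] is a row kernel {u | u *m H = 0}; this is {x | H *m x = 0}. *)
Definition null_space (R : realType) (m : nat) (H : 'M[R]_m) :
    {vspace 'cV[R]_m} :=
  lker (linfun (mulmx H : 'cV[R]_m -> 'cV[R]_m)).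

Definition arrow_block (R : realType) (n : nat)
    (A : 'M[R]_n) (v : 'cV[R]_n) (alpha : R) : 'M[R]_(n + 1) :=
  block_mx A v v^T alpha%:M.

(* Blocks are numbered from 0, so the first and last ones are 0 and N - 1.
   The size \sum_(i < N) (n + 1), equal to N * (n + 1), is the form in which
   [\mxdiag] types a block diagonal matrix. *)
Definition admissible (R : realType) (N n : nat)
    (H : 'M[R]_(\sum_(i < N) (n + 1))) : Prop :=
  exists (A : 'I_N -> 'M[R]_n) (v : 'I_N -> 'cV[R]_n) (alpha : 'I_N -> R),
    [/\ H = \mxdiag_(i < N) arrow_block (A i) (v i) (alpha i),
        forall i : 'I_N, i = 0%N :> nat \/ i = N.-1 :> nat ->
          sym_posdef (A i) \/ sym_negdef (A i),
        forall i : 'I_N, (0 < i < N.-1)%N -> A i = 0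
      & forall i : 'I_N, (0 < i < N.-1)%N -> v i != 0 \/ alpha i != 0].

(* Main.v *)
(* The nullity of a block diagonal matrix is the sum of the nullities of its
   blocks. An end block contains an invertible n x n corner, so its nullity is
   at most 1; a middle block is nonzero, so its nullity is at most n. Taking
   v_i = 0 throughout, A_i = 1 and alpha_i = 0 at the ends, and alpha_i = 1 in
   the middle, attains all these bounds at once. *)
Require Import Defs.
From mathcomp Require Import all_boot all_order all_algebra.
From mathcomp Require Import reals.

Import Order.TTheory GRing.Theory Num.Theory.
Local Open Scope ring_scope.

(** Multiplying by [row_mx 1%:M 0] on the left and [col_mx 1%:M 0] on the right cuts out the corner,
    and products never raise the rank. *)
Lemma mxrank_submx_ul (F : fieldType) (m1 m2 n1 n2 : nat)
    (M : 'M[F]_(m1 + m2, n1 + n2)) : (\rank (ulsubmx M) <= \rank M)%N.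
Proof.
have -> : ulsubmx M = row_mx 1%:M 0 *m M *m col_mx 1%:M 0.
  rewrite -[in RHS](submxK M) mul_row_block mul_row_col.
  by rewrite !mul1mx !mul0mx mulmx0 mulmx1 !addr0.
exact: leq_trans (mxrankM_maxl _ _) (mxrankM_maxr _ _).
Qed.

(** If [u *m A = 0], the quadratic form of [A] vanishes at [u^T], which definiteness of either sign
    forbids unless [u = 0]. *)
Lemma definite_rank (R : realType) (n : nat) (A : 'M[R]_n) :
  sym_posdef A \/ sym_negdef A -> \rank A = n.
Proof.
move=> defA; apply/eqP/inj_row_free => u uA0.
apply/eqP/contraT => u0.
have x0 : u^T != 0 by rewrite trmx_eq0.
by case: defA => [] [_ /(_ _ x0)]; rewrite trmxK uA0 mul0mx mxE ltxx.
Qed.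

Lemma dim_null_space (R : realType) (m : nat) (H : 'M[R]_m) :
  \dim (null_space H) = (m - \rank H)%N.
Proof.
(* The columns of K form a basis of the null space. *)
pose K := (row_base (kermx H^T))^T.
have KE (w : 'cV[R]_m) : H *m w = 0 <-> exists y, w = K *m y.
  split=> [Hw|[y ->]].
    have /submxP[D wD] : (w^T <= row_base (kermx H^T))%MS.
      by rewrite eq_row_base; apply/sub_kermxP; rewrite -trmx_mul Hw trmx0.
    by exists D^T; rewrite -trmx_mul -wD trmxK.
  rewrite mulmxA; suff -> : H *m K = 0 by rewrite mul0mx.
  apply: trmx_inj; rewrite trmx_mul trmxK trmx0.
  by apply/sub_kermxP; rewrite eq_row_base.
have KI : lker (linfun (mulmx K : 'cV[R]_ _ -> 'cV[R]_ _)) == 0%VS.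
  apply/lker0P => x y; rewrite !lfunE /= => /(congr1 trmx).
  by rewrite !trmx_mul trmxK => /(row_free_inj (row_base_free _)) /trmx_inj.
(* As the image of an injective map, the null space has as many dimensions as [K] has columns,
   namely [\rank (kermx H^T)]. *)
have -> : null_space H = limg (linfun (mulmx K : 'cV[R]_ _ -> 'cV[R]_ _)).
  apply/vspaceP => w; rewrite memv_ker lfunE /=; apply/eqP/memv_imgP.
    by move=> /KE [y ->]; exists y; rewrite ?memvf ?lfunE.
  by move=> [y _ ->]; rewrite lfunE; apply/KE; exists y.
rewrite limg_dim_eq; last by rewrite (eqP KI) capv0.
by rewrite dimvf /dim /= muln1 mxrank_ker mxrank_tr.
Qed.

Lemma dim_null_space_mxdiag (R : realType) (N k : nat) (B : 'I_N -> 'M[R]_k) :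
  \dim (null_space (\mxdiag_(i < N) B i)) =
    (\sum_(i < N) (k - \rank (B i)))%N.
Proof.
rewrite dim_null_space rank_mxdiag sumnB // => i _; exact: rank_leq_row.
Qed.

Lemma sum_ends_middle (N n : nat) : (2 <= N)%N ->
  (\sum_(i < N) (if 0 < i < N.-1 then n else 1) = (N - 2) * n + 2)%N.
Proof.
case: N => [|[|N]] // _.
rewrite big_ord_recl big_ord_recr /= ltnn.
rewrite (eq_bigr (fun=> n)) => [|i _]; last by rewrite /bump /= add1n ltnS ltn_ord.
by rewrite sum_nat_const card_ord subn2 /= addnCA.
Qed.

Theorem theorem3 (R : realType) (N n : nat) (hN : (2 <= N)%N) :
  (exists H : 'M[R]_(\sum_(i < N) (n + 1)),
      admissible H /\ \dim (null_space H) = ((N - 2) * n + 2)%N) /\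
  (forall H : 'M[R]_(\sum_(i < N) (n + 1)),
      admissible H -> (\dim (null_space H) <= (N - 2) * n + 2)%N).
Proof.
have endP (i : 'I_N) : ~~ (0 < i < N.-1)%N -> i = 0%N :> nat \/ i = N.-1 :> nat.
  case: i => i /= ltiN; rewrite negb_and -eqn0Ngt -leqNgt => /orP[/eqP|le]; first by left.
  by right; apply/eqP; rewrite eqn_leq le -ltnS prednK ?ltiN // (leq_trans _ hN).
(* With the bound spelled out as a sum over blocks, both halves reduce to comparing nullities block
   by block. *)
rewrite -(sum_ends_middle _ n hN); split.
  pose mid (i : 'I_N) := (0 < i < N.-1)%N.
  pose A (i : 'I_N) : 'M[R]_n := if mid i then 0 else 1%:M.
  pose a (i : 'I_N) : R := (mid i)%:R.
  exists (\mxdiag_(i < N) arrow_block (A i) 0 (a i)); split.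
    exists A, (fun=> 0), a; split=> // i.
    - move=> ends; have /negbTE midF : ~~ mid i.
        by rewrite /mid; case: ends => ->; rewrite ?ltnn ?andbF.
      left; rewrite /A midF; split; first exact: trmx1.
      (* The form at [x] is the sum of the squares of its entries, which vanishes only if every
         entry does. *)
      move=> x x0; rewrite mulmx1 mxE lt0r sumr_ge0 ?andbT; last first.
        by move=> j _; rewrite mxE -expr2 sqr_ge0.
      apply: contra x0; rewrite psumr_eq0 => [/allP x0|j _]; last first.
        by rewrite mxE -expr2 sqr_ge0.
      apply/eqP/colP => j; apply/eqP; rewrite mxE -sqrf_eq0 expr2.
      by have := x0 j (mem_index_enum _); rewrite mxE.
    - by rewrite /A /mid => ->.
    - by rewrite /a /mid => ->; right; rewrite oner_eq0.
  rewrite dim_null_space_mxdiag; apply: eq_bigr => i _.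
  (* Since [v] is zero, the ranks of the two diagonal parts add: [0 + 1] in the middle, [n + 0] at
     the ends. *)
  rewrite /arrow_block trmx0 rank_diag_block_mx /A /a -/(mid i).
  case: (mid i); first by rewrite mxrank0 mxrank1 add0n addnK.
  by rewrite raddf0 mxrank0 mxrank1 addn0 addKn.
move=> H [A [v [a [-> Aend Amid vamid]]]].
rewrite dim_null_space_mxdiag; apply: leq_sum => i _.
case: ifPn => [imid|/endP/Aend defA].
  (* It remains to see that a middle block has positive rank, that is, is nonzero. *)
  rewrite leq_subLR [leqRHS]addnC leq_add2l lt0n mxrank_eq0.
  rewrite block_mx_eq0; apply/negP => /and4P[_ /eqP v0 _ /eqP/matrixP/(_ 0 0)].
  by rewrite !mxE => a0; case: (vamid i imid) => /eqP.
(* An end block has rank at least that of its definite corner, which is [n]. *)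
rewrite leq_subLR leq_add2r -[leqLHS](definite_rank _ _ _ defA).
rewrite -[A i in leqLHS](block_mxKul _ (v i) (v i)^T (a i)%:M).
exact: mxrank_submx_ul.
Qed.
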